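(* Every proper idempotent element of $L$ is $\phi_\omega$-$\delta$-primary, and hence $\phi_n$-$\delta$-primary for every integer $n\geqslant 2$.
   Context: A multiplicative lattice is a complete lattice (least element $0$, greatest element $1$) with a commutative, associative multiplication that distributes over arbitrary joins and for which $1$ is the identity. An element $a$ is compact if $a\leqslant \bigvee X$ with $X\subseteq L$ implies $a\leqslant a_1\vee\dots\vee a_n$ for finitely many $a_i\in X$; $L$ is compactly generated if every element is a join of compact elements. Standing assumptions: $L$ is a compactly generated multiplicative lattice in which $1$ is compact and every finite product of compact elements is compact; $\delta:L\to L$ is an expansion function, i.e. $a\leqslant\delta(a)$ for all $a$, and $a\leqslant b$ implies $\delta(a)\leqslant\delta(b)$. An element $p$ is proper if $p<1$ and idempotent if $p=p^2$. For $\phi:L\to L$, a proper element $p$ is $\phi$-$\delta$-primary if for all $a,b\in L$, $ab\leqslant p$ and $ab\not\leqslant\phi(p)$ implies $a\leqslant p$ or $b\leqslant\delta(p)$. Special functions: $\phi_n(p)=p^n$ for $n\geqslant 2$ and $\phi_\omega(p)=\bigwedge_{i=1}^{\infty}p^i$. *)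

(* Defs.v *)
From HB Require Import structures.
From mathcomp Require Import all_boot all_order.
From mathcomp Require Import boolp classical_sets.

Set Implicit Arguments.
Unset Strict Implicit.
Unset Printing Implicit Defensive.

Import Order.TTheory.

Local Open Scope classical_set_scope.
Local Open Scope order_scope.
Local Open Scope group_scope.

(* [supremum x0 X] returns [x0] when [X] is empty, so the defaults [\bot] and
   [\top] give the empty join and the empty meet their usual values. *)
Definition bigjoin d (L : tbLatticeType d) (X : set L) : L := supremum \bot X.
Definition bigmeet d (L : tbLatticeType d) (X : set L) : L := infimum \top X.

(* [supremums_neq0] is completeness: every subset has a least upper bound, hence
   also every subset has a greatest lower bound.  [mulg_bigjoin] includes the
   empty join, i.e. [a * \bot = \bot]. *)
HB.mixin Record isMultiplicativeLattice d L
    of Order.TBLattice d L & monoid.Monoid L := {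
  supremums_neq0 : forall X : set L, supremums X !=set0;
  mulgC : commutative (@mul L);
  mulg_bigjoin : forall (a : L) (X : set L),
    a * bigjoin X = bigjoin [set a * x | x in X];
  oneg_top : (1 : L) = \top
}.

#[short(type="multLatticeType")]
HB.structure Definition MultiplicativeLattice d :=
  { L of isMultiplicativeLattice d L & Order.TBLattice d L & monoid.Monoid L }.

Section Definitions.
Context {d : Order.disp_t} {L : multLatticeType d}.
Implicit Types (a b p : L) (delta phi : L -> L).

Definition compact_element a : Prop :=
  forall X : set L, a <= bigjoin X ->
  exists s : seq L, {in s, forall x, X x} /\ a <= \join_(x <- s) x.

Definition compactly_generated : Prop :=
  forall a, exists X : set L,
    (forall x, X x -> compact_element x) /\ a = bigjoin X.

Definition finite_products_compact : Prop :=
  forall s : seq L, {in s, forall x, compact_element x} ->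
    compact_element (\prod_(x <- s) x).

Definition expansion_function delta : Prop :=
  (forall a, a <= delta a) /\ {homo delta : a b / a <= b}.

Definition proper_element p : Prop := p < 1.

Definition idempotent_element p : Prop := p = p ^+ 2.

Definition phi_delta_primary phi delta p : Prop :=
  proper_element p /\
  forall a b, a * b <= p -> ~ (a * b <= phi p) -> a <= p \/ b <= delta p.

Definition phi_pow (n : nat) p : L := p ^+ n.

Definition phi_omega p : L := bigmeet [set p ^+ i | i in [set i | (1 <= i)%N]].

End Definitions.

Arguments compactly_generated {d} L.
Arguments finite_products_compact {d} L.

(* Main.v *)
Require Import Defs.
From mathcomp Require Import all_boot all_order.
From mathcomp Require Import boolp classical_sets.

(** An element p with p <= phi p is phi-delta-primary for a vacuous reason: no
    product ab can lie below p without lying below phi p.  All positive powers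
    of an idempotent coincide with it, so an idempotent p is fixed both by
    phi_n and by phi_omega, the latter being the meet of the singleton {p}. *)

Set Implicit Arguments.
Unset Strict Implicit.
Unset Printing Implicit Defensive.

Import Order.TTheory.

Local Open Scope classical_set_scope.
Local Open Scope order_scope.
Local Open Scope group_scope.

Lemma infimum1 d (T : porderType d) (x0 x : T) : infimum x0 [set x] = x.
Proof.
rewrite /infimum infimums1 ifN; first by apply: xget_subset1 => // y z -> ->.
by apply/set0P; exists x.
Qed.

Section IdempotentElements.
Context {d : Order.disp_t} {L : multLatticeType d}.
Implicit Types (p : L) (delta phi : L -> L).

Lemma phi_delta_primary_le phi delta p :
  proper_element p -> p <= phi p -> phi_delta_primary phi delta p.
Proof.
move=> p_proper le_p_phip; split=> // a b le_ab_p nle_ab_phip.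
by case: nle_ab_phip; apply: le_trans le_p_phip.
Qed.

Lemma idempotent_expgS p n : idempotent_element p -> p ^+ n.+1 = p.
Proof.
move=> p_idem; elim: n => [|n IHn]; first by rewrite expg1.
by rewrite expgS IHn -expg2 -p_idem.
Qed.

Lemma phi_omega_idempotent p : idempotent_element p -> phi_omega p = p.
Proof.
move=> p_idem; rewrite /phi_omega /bigmeet.
suff -> : [set p ^+ i | i in [set i | (1 <= i)%N]] = [set p].
  exact: infimum1.
apply/seteqP; split=> [_ [[|i] //= _ <-]|_ ->]; first exact: idempotent_expgS.
by exists 1%N; rewrite ?expg1.
Qed.

End IdempotentElements.

Theorem theorem2p46 (d : Order.disp_t) (L : multLatticeType d)
    (L_compactly_generated : compactly_generated L)
    (one_compact : compact_element (1%g : L))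
    (products_compact : finite_products_compact L)
    (delta : L -> L) (delta_expansion : expansion_function delta)
    (p : L) (p_proper : proper_element p) (p_idempotent : idempotent_element p) :
  phi_delta_primary phi_omega delta p /\
  (forall n : nat, (2 <= n)%N -> phi_delta_primary (phi_pow n) delta p).
Proof.
split=> [|[|n] // _]; apply: phi_delta_primary_le => //.
  by rewrite phi_omega_idempotent.
by rewrite /phi_pow idempotent_expgS.
Qed.
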